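(* For an integer $\alpha\neq0,1$ let $\beta=(2\alpha-1)(\alpha-1)$ and $$E_8:\ y^2+(\alpha-\beta)xy-\alpha^3\beta y=x^3-\alpha^2\beta x^2,$$ an elliptic curve (in Tate normal form, rescaled to be integral) on which $P=(0,0)$ is a torsion point of order $8$. Let $G_n=\phi_n(P)$ and $H_n=\omega_n(P)$, $n\geq 0$, be the sequences of numerators of the $x$- and $y$-coordinates of the multiples of $P$. 1. Let $n\ge0$ be such that $G_n\neq0$. (i) If $n\equiv0\ (8)$, then $G_n=\square$ for all $\alpha\ne0,1$; if $n\equiv2,6\ (8)$, then $G_n=\square$ iff $(\alpha-1)(2\alpha-1)=\square$; otherwise $G_n\ne\square$ for all $\alpha\neq0,1$. (ii) If $n\equiv0\ (24)$, then $G_n=C$ for all $\alpha\ne0,1$; if $n\equiv2,10,14,22\ (24)$, then $G_n=C$ iff $\alpha=C$; if $n\equiv8,16\ (24)$, then $G_n=C$ iff $\alpha-1=C$; otherwise $G_n\neq C$ for all $\alpha\ne0,1$. 2. Let $n\ge0$ be such that $H_n\neq0$. (i) If $n\equiv0,4,8,12\ (16)$, then $H_n=\square$ for all $\alpha\ne0,1$; if $n\equiv3\ (16)$, then $H_n=\square$ iff $\alpha-1=\square$; if $n\equiv5,7\ (16)$, then $H_n=\square$ iff $2\alpha-1=\square$; if $n\equiv11\ (16)$, then $H_n=\square$ iff $\alpha=\square$; otherwise $H_n\ne\square$ for all $\alpha\ne0,1$. (ii) If $n\equiv0\ (8)$, then $H_n=C$ for all $\alpha\ne0,1$; otherwise $H_n\ne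 C$ for all $\alpha\neq0,1$.
   Context: Notation: ''$m=\square$'' means $m=\pm k^2$ for some non-zero integer $k$ (note the sign $\pm$); ''$m=C$'' means $m=k^3$ for some non-zero integer $k$; $n\equiv r\ (N)$ means congruence modulo $N$. Division polynomials. For an elliptic curve $y^{2}+a_{1}xy+a_{3}y=x^{3}+a_{2}x^{2}+a_{4}x+a_{6}$ put $b_2=a_1^2+4a_2$, $b_4=2a_4+a_1a_3$, $b_6=a_3^2+4a_6$, $b_8=a_1^2a_6+4a_2a_6-a_1a_3a_4+a_2a_3^2-a_4^2$. Define $\psi_0=0$, $\psi_1=1$, $\psi_2=2y+a_1x+a_3$, $\psi_3=3x^4+b_2x^3+3b_4x^2+3b_6x+b_8$, $\psi_4=\psi_2\,(2x^6+b_2x^5+5b_4x^4+10b_6x^3+10b_8x^2+(b_2b_8-b_4b_6)x+(b_4b_8-b_6^2))$, and $\psi_{2n+1}=\psi_{n+2}\psi_n^3-\psi_{n-1}\psi_{n+1}^3$ $(n\ge2)$, $\psi_{2n}\psi_2=\psi_{n-1}^2\psi_n\psi_{n+2}-\psi_{n-2}\psi_n\psi_{n+1}^2$ $(n\ge3)$. Further $\phi_0=1$, $\phi_1=x$, $\omega_0=1$, $\omega_1=y$, and for $n\ge2$: $\phi_n=x\psi_n^2-\psi_{n+1}\psi_{n-1}$, $\omega_n=\bigl(\psi_{n-1}^2\psi_{n+2}-\psi_{n-2}\psi_{n+1}^2-\psi_2\psi_n(a_1\phi_n+a_3\psi_n^2)\bigr)/(2\psi_2)$. If $\psi_n(P)\ne0$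 then $[n]P=(\phi_n(P)/\psi_n(P)^2,\ \omega_n(P)/\psi_n(P)^3)$. *)

(* Defs.v *)
From mathcomp Require Import all_boot all_order all_algebra.
From mathcomp Require Import zify ring.

Set Implicit Arguments.
Unset Strict Implicit.
Unset Printing Implicit Defensive.

Import Order.TTheory GRing.Theory Num.Theory.
Local Open Scope ring_scope.

Definition is_pm_square (R : nzRingType) (m : R) : Prop :=
  exists2 k : int, k != 0 & m = (k ^+ 2)%:~R \/ m = (- (k ^+ 2))%:~R.

Definition is_cube (R : nzRingType) (m : R) : Prop :=
  exists2 k : int, k != 0 & m = (k ^+ 3)%:~R.

(* y^2 + a1 x y + a3 y = x^3 + a2 x^2 + a4 x + a6 *)
Record weierstrass := Weierstrass {
  a1 : rat; a2 : rat; a3 : rat; a4 : rat; a6 : rat }.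

(* Q[x][y]: the outer variable is y, the inner one is x.  The division
   polynomials are taken here, without reduction modulo the curve equation. *)
Definition bipoly : Type := {poly {poly rat}}.

Definition cst (c : rat) : bipoly := c%:P%:P.
Definition varx : bipoly := 'X%:P.
Definition vary : bipoly := 'X.
Definition eval_at (p : bipoly) (x y : rat) : rat := p.[y%:P].[x].

Definition b2 (W : weierstrass) : rat := a1 W ^+ 2 + 4 * a2 W.
Definition b4 (W : weierstrass) : rat := 2 * a4 W + a1 W * a3 W.
Definition b6 (W : weierstrass) : rat := a3 W ^+ 2 + 4 * a6 W.
Definition b8 (W : weierstrass) : rat :=
  a1 W ^+ 2 * a6 W + 4 * a2 W * a6 W - a1 W * a3 W * a4 W
  + a2 W * a3 W ^+ 2 - a4 W ^+ 2.

Definition psi2 (W : weierstrass) : bipoly :=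
  2 * vary + cst (a1 W) * varx + cst (a3 W).

Definition psi3 (W : weierstrass) : bipoly :=
  3 * varx ^+ 4 + cst (b2 W) * varx ^+ 3 + 3 * cst (b4 W) * varx ^+ 2
  + 3 * cst (b6 W) * varx + cst (b8 W).

Definition psi4 (W : weierstrass) : bipoly :=
  psi2 W *
  (2 * varx ^+ 6 + cst (b2 W) * varx ^+ 5 + 5 * cst (b4 W) * varx ^+ 4
   + 10 * cst (b6 W) * varx ^+ 3 + 10 * cst (b8 W) * varx ^+ 2
   + cst (b2 W * b8 W - b4 W * b6 W) * varx
   + cst (b4 W * b8 W - b6 W ^+ 2)).

(* The recursion is on the bound k, irrelevant once n < k.  The Euclidean
   quotient by psi2 (in y, with invertible leading coefficient 2) is exact:
   see psi_even and omegaE. *)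
Fixpoint psi_rec (W : weierstrass) (k n : nat) : bipoly :=
  if k is k'.+1 then
    let psi := psi_rec W k' in
    match n with
    | 0 => 0
    | 1 => 1
    | 2 => psi2 W
    | 3 => psi3 W
    | 4 => psi4 W
    | _ =>
      let m := n./2 in
      if odd n
      then psi m.+2 * psi m ^+ 3 - psi m.-1 * psi m.+1 ^+ 3
      else (psi m.-1 ^+ 2 * psi m * psi m.+2
            - psi m.-2 * psi m * psi m.+1 ^+ 2) %/ psi2 W
    end
  else 0.

Definition psi (W : weierstrass) (n : nat) : bipoly := psi_rec W n.+1 n.

Definition phi (W : weierstrass) (n : nat) : bipoly :=
  match n with
  | 0 => 1
  | 1 => varx
  | _ => varx * psi W n ^+ 2 - psi W n.+1 * psi W n.-1
  end.

Definition omega_num (W : weierstrass) (n : nat) : bipoly :=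
  psi W n.-1 ^+ 2 * psi W n.+2 - psi W n.-2 * psi W n.+1 ^+ 2
  - psi W 2 * psi W n
    * (cst (a1 W) * phi W n + cst (a3 W) * psi W n ^+ 2).

Definition omega (W : weierstrass) (n : nat) : bipoly :=
  match n with
  | 0 => 1
  | 1 => vary
  | _ => omega_num W n %/ (2 * psi W 2)
  end.

Definition beta (alpha : int) : int := (2 * alpha - 1) * (alpha - 1).

Definition E8 (alpha : int) : weierstrass :=
  {| a1 := (alpha - beta alpha)%:~R;
     a2 := (- (alpha ^+ 2 * beta alpha))%:~R;
     a3 := (- (alpha ^+ 3 * beta alpha))%:~R;
     a4 := 0;
     a6 := 0 |}.

Definition Gseq (alpha : int) (n : nat) : rat := eval_at (phi (E8 alpha) n) 0 0.
Definition Hseq (alpha : int) (n : nat) : rat := eval_at (omega (E8 alpha) n) 0 0.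

Lemma psi_rec_bound W k l n : (n < k)%N -> (n < l)%N ->
  psi_rec W k n = psi_rec W l n.
Proof.
elim: k l n => // k IH [|l] // n ltnk ltnl.
have eq_lt m : (m < n)%N -> psi_rec W k m = psi_rec W l m.
  by move=> ltmn; apply: IH; lia.
case: n ltnk ltnl eq_lt => [|[|[|[|[|n]]]]] // _ _ eq_lt.
have En := odd_double_half n.
by rewrite /= !eq_lt //; lia.
Qed.

Lemma psi0 W : psi W 0 = 0. Proof. by []. Qed.
Lemma psi1 W : psi W 1 = 1. Proof. by []. Qed.
Lemma psi2E W : psi W 2 = psi2 W. Proof. by []. Qed.
Lemma psi3E W : psi W 3 = psi3 W. Proof. by []. Qed.
Lemma psi4E W : psi W 4 = psi4 W. Proof. by []. Qed.

Lemma psi_recE W k n : (n < k)%N -> psi_rec W k n = psi W n.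
Proof. by move=> ltnk; apply: psi_rec_bound. Qed.

Lemma psi_unfold W n : (4 < n)%N ->
  psi W n =
    if odd n
    then psi W n./2.+2 * psi W n./2 ^+ 3 - psi W n./2.-1 * psi W n./2.+1 ^+ 3
    else (psi W n./2.-1 ^+ 2 * psi W n./2 * psi W n./2.+2
          - psi W n./2.-2 * psi W n./2 * psi W n./2.+1 ^+ 2) %/ psi2 W.
Proof.
move=> lt4n; have En := odd_double_half n; rewrite [LHS]/psi.
suff E k : (n <= k)%N -> psi_rec W k.+1 n =
    if odd n
    then psi W n./2.+2 * psi W n./2 ^+ 3 - psi W n./2.-1 * psi W n./2.+1 ^+ 3
    else (psi W n./2.-1 ^+ 2 * psi W n./2 * psi W n./2.+2
          - psi W n./2.-2 * psi W n./2 * psi W n./2.+1 ^+ 2) %/ psi2 W.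
  by apply: E.
move=> lenk; have psiE m : (m < n)%N -> psi_rec W k m = psi W m.
  by move=> ltmn; apply: psi_recE; lia.
have E : psi_rec W k.+1 n = let psi := psi_rec W k in
    if odd n
    then psi n./2.+2 * psi n./2 ^+ 3 - psi n./2.-1 * psi n./2.+1 ^+ 3
    else (psi n./2.-1 ^+ 2 * psi n./2 * psi n./2.+2
          - psi n./2.-2 * psi n./2 * psi n./2.+1 ^+ 2) %/ psi2 W.
  by case: (n) lt4n => [|[|[|[|[|]]]]].
by rewrite {}E; cbv zeta; rewrite !psiE //; lia.
Qed.

Lemma psi_odd W n : (2 <= n)%N ->
  psi W n.*2.+1
    = psi W n.+2 * psi W n ^+ 3 - psi W n.-1 * psi W n.+1 ^+ 3.
Proof.
move=> le2n; rewrite psi_unfold; last by lia.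
by rewrite /= odd_double /= uphalf_double.
Qed.

Lemma psi_even_div W n : (3 <= n)%N ->
  psi W n.*2
    = (psi W n.-1 ^+ 2 * psi W n * psi W n.+2
       - psi W n.-2 * psi W n * psi W n.+1 ^+ 2) %/ psi2 W.
Proof.
move=> le3n; rewrite psi_unfold; last by lia.
by rewrite odd_double doubleK.
Qed.

Lemma lead_coef_psi2 W : lead_coef (psi2 W) = 2.
Proof.
have -> : psi2 W = 2%:P * 'X + ((a1 W)%:P * 'X + (a3 W)%:P)%:P.
  by rewrite /psi2 /cst /varx /vary -addrA (polyCD (_ * _)) polyCM polyC_natr.
have n2 : (2%:P : bipoly) != 0 by rewrite polyC_eq0 -polyC_natr polyC_eq0.
rewrite lead_coefDl ?lead_coefM ?lead_coefC ?lead_coefX ?mulr1 //.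
by rewrite size_mulX // !size_polyC -(polyC_eq0 2) n2; case: (_ != 0).
Qed.

Lemma psi2_neq0 W : psi2 W != 0.
Proof. by rewrite -lead_coef_eq0 lead_coef_psi2 -polyC_natr polyC_eq0. Qed.

Lemma natr_poly_unit n : (n.+1%:R : {poly rat}) \is a GRing.unit.
Proof. by rewrite -polyC_natr poly_unitE size_polyC coefC unitfE pnatr_eq0. Qed.

Lemma divpK_psi2 W (c : nat) (p q : bipoly) :
  p = q * psi2 W -> p %/ (c.+1%:R * psi2 W) * (c.+1%:R * psi2 W) = p.
Proof.
move=> ->; have uc := natr_poly_unit c.
apply: Pdiv.IdomainUnit.divpK.
  rewrite -polyC_natr lead_coefM lead_coefC lead_coef_psi2.
  by rewrite unitrM uc (natr_poly_unit 1).
apply: dvdp_mull; apply/Pdiv.Idomain.dvdpP; exists (1, (c.+1%:R^-1)%:P).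
  exact: oner_neq0.
by rewrite scale1r -(polyC_natr {poly rat}) mulrA -polyCM mulVr // mul1r.
Qed.

Definition psi_even_num W n : bipoly :=
  psi W n.-1 ^+ 2 * psi W n * psi W n.+2
  - psi W n.-2 * psi W n * psi W n.+1 ^+ 2.

Lemma psi_even_num_dvd W n :
  (forall j, ~~ odd j -> (j <= n.+2)%N -> exists q, psi W j = q * psi2 W) ->
  (3 <= n)%N -> exists r, psi_even_num W n = r * psi2 W * psi2 W.
Proof.
move=> ev le3n; rewrite /psi_even_num; have [on|en] := boolP (odd n).
  have [||q1 ->] := ev n.-1; [lia..|].
  have [||q2 ->] := ev n.+1; [lia..|].
  exists (q1 ^+ 2 * psi W n * psi W n.+2 - psi W n.-2 * psi W n * q2 ^+ 2).
  by ring.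
have [||q1 ->] := ev n; [lia..|].
have [||q2 ->] := ev n.+2; [lia..|].
have [||q3 ->] := ev n.-2; [lia..|].
exists (psi W n.-1 ^+ 2 * q1 * q2 - q3 * q1 * psi W n.+1 ^+ 2).
by ring.
Qed.

Lemma psi_even_psi2 W n : ~~ odd n -> exists q, psi W n = q * psi2 W.
Proof.
have [m] := ubnP n; elim: m n => // m IH n ltnm en.
have [lt5n|] := ltnP 5 n; last first.
  case: n ltnm en => [|[|[|[|[|[|]]]]]] // _ _ _.
  - by exists 0; rewrite mul0r.
  - by exists 1; rewrite mul1r.
  - by rewrite psi4E /psi4 mulrC; eexists.
have En := odd_double_half n; have {1}-> : n = (n./2).*2 by lia.
have [||r Er] := @psi_even_num_dvd W n./2; [|lia|].
  by move=> j ej lej; apply: IH => //; lia.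
exists r; rewrite psi_even_div -/(psi_even_num _ _) ?Er; last by lia.
apply: (mulIf (psi2_neq0 W)).
by have := divpK_psi2 0 (erefl (r * psi2 W * psi2 W)); rewrite mul1r.
Qed.

Lemma psi_even W n : (3 <= n)%N ->
  psi W n.*2 * psi W 2
    = psi W n.-1 ^+ 2 * psi W n * psi W n.+2
      - psi W n.-2 * psi W n * psi W n.+1 ^+ 2.
Proof.
move=> le3n; rewrite psi_even_div // -/(psi_even_num W n).
have [|r Er] := @psi_even_num_dvd W n _ le3n.
  by move=> j ej _; apply: psi_even_psi2.
by have := divpK_psi2 0 Er; rewrite mul1r.
Qed.

Lemma omegaE W n : (2 <= n)%N ->
  omega W n * (2 * psi W 2) = omega_num W n.
Proof.
move=> le2n.
suff [r Er] : exists r, omega_num W n = r * psi2 W.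
  by case: n le2n Er => [|[|n]] // _ Er; apply: (divpK_psi2 1 Er).
rewrite /omega_num psi2E; set t := cst _ * _ + _.
have [on|en] := boolP (odd n).
  have [|q1 ->] := @psi_even_psi2 W n.-1; first by lia.
  have [|q2 ->] := @psi_even_psi2 W n.+1; first by lia.
  exists (q1 ^+ 2 * psi2 W * psi W n.+2 - psi W n.-2 * q2 ^+ 2 * psi2 W
          - psi W n * t).
  by ring.
have [|q1 ->] := @psi_even_psi2 W n.+2; first by lia.
have [|q2 ->] := @psi_even_psi2 W n.-2; first by lia.
exists (psi W n.-1 ^+ 2 * q1 - q2 * psi W n.+1 ^+ 2 - psi W n * t).
by ring.
Qed.

(* Main.v *)
Require Import Defs.
From mathcomp Require Import all_boot all_order all_algebra.
From mathcomp Require Import zify ring.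

Set Implicit Arguments.
Unset Strict Implicit.
Unset Printing Implicit Defensive.

Import Order.TTheory GRing.Theory Num.Theory.
Local Open Scope ring_scope.

(** Write [x = alpha], [y = alpha - 1], [z = 2 alpha - 1]; for [alpha] different
    from 0 and 1, these integers are nonzero and pairwise coprime.  Because
    [P] has order 8, the values of the division polynomials at [P] form an
    elliptic divisibility sequence that repeats with period 8 up to a power of
    one fixed monomial, [t = - x^15 y^7 z^6]:
    [psi_(8k+r)(P) = (-1)^k t^(4k^2+rk) psi_r(P)], and [psi_r(P)] is itself
    zero or a signed monomial in [x, y, z] for every [r].  The closed form
    (lemma [psi_at_P]) is checked against the two recurrences, both of which
    are homogeneous for the factor [(-1)^k t^(4k^2+rk)], so that only one
    period has to be verified.  The numerators [G_n] and [H_n] inherit the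
    shape: when nonzero, they are up to sign [x^a y^b z^c] with explicit
    exponents (lemmas [Gseq_monomial] and [Hseq_monomial]).

    By coprimality, [x^a y^b z^c] is plus or minus a [p]-th power, for a prime
    [p], iff each of [x, y, z] whose exponent is not divisible by [p] is one
    (lemma [perfect_power_monomial]).  For [p = 2, 3] the exponents modulo [p]
    depend only on [n] modulo 16 or 24, and what is left to show is that
    certain pairs among [x, y, z] are never simultaneously perfect.
    Consecutive integers are both plus or minus squares, or both cubes, only
    for [alpha = 0, 1].  That [alpha] and [2 alpha - 1], or [alpha - 1] and
    [2 alpha - 1], are not both cubes is the equation [v^3 + 1 = 2 u^3], which
    has no solution besides the trivial ones [u = v = 1] and [u = 0], [v = -1].
    This is Euler's theorem on [x^3 + y^3 = 2 z^3] (lemma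
    [sum_cubes_eq_double_cube]), proved by infinite descent: setting
    [x = a + b] and [y = a - b], the equation becomes
    [a (a^2 + 3 b^2) = z^3], and a cube of the form [a^2 + 3 b^2] comes from
    the cube of an element [p + q sqrt(-3)] (lemma
    [norm_form_cube]).  *)

(** * Perfect powers of natural numbers *)

Definition perfect_power (k m : nat) : Prop := exists d, m = (d ^ k)%N.

(** If [m n = c^k] with [m], [n] coprime, then [m] is the [k]-th power of
    [gcd(m, c)]. *)
Lemma perfect_power_coprimeM k m n : coprime m n ->
  perfect_power k (m * n) <-> perfect_power k m /\ perfect_power k n.
Proof.
move=> co_mn; split=> [[c Ec]|[[d ->] [e ->]]]; last first.
  by exists (d * e)%N; rewrite expnMn.
suff aux a b : coprime a b -> (a * b = c ^ k)%N -> perfect_power k a.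
  by split; [apply: (aux m n)|apply: (aux n m); rewrite 1?coprime_sym 1?mulnC].
case: k {Ec} => [|k] co_ab Ec.
  exists 1%N; apply/eqP; move/eqP: Ec.
  by rewrite !expn0 muln_eq1 => /andP[/eqP-> _].
have [a0|a_gt0] := posnP a; first by exists 0%N; rewrite a0 exp0n.
set g := gcdn a c; have g_gt0 : (0 < g)%N by rewrite gcdn_gt0 a_gt0.
have [a' Ea] := dvdnP (dvdn_gcdl a c); have [c' Ec'] := dvdnP (dvdn_gcdr a c).
rewrite -/g in Ea Ec'.
have co_ac : coprime a' c'.
  by rewrite /coprime -(eqn_pmul2r g_gt0) mul1n muln_gcdl -Ea -Ec'.
have co_gb : coprime g b by apply: coprime_dvdl co_ab; rewrite Ea dvdn_mull.
have E : (a' * b = g ^ k * c' ^ k.+1)%N.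
  apply/eqP; rewrite -(eqn_pmul2r g_gt0); apply/eqP.
  by rewrite mulnAC -Ea Ec Ec' expnMn (expnSr g); ring.
(* [a'] and [g^k] divide each other *)
exists g; rewrite expnSr {1}Ea; congr (_ * _)%N; apply/eqP.
rewrite eqn_dvd; apply/andP; split.
  by rewrite -(Gauss_dvdl _ (coprimeXr k.+1 co_ac)) -E dvdn_mulr.
by rewrite -(Gauss_dvdl _ (coprimeXl k co_gb)) E dvdn_mulr.
Qed.

(** When [k] does not divide [a], a Bezout relation [u a = v k + 1] exhibits
    [m (m^v)^k] as a [k]-th power. *)
Lemma perfect_power_exp k a m : prime k -> (0 < m)%N ->
  perfect_power k (m ^ a) <-> (k %| a)%N \/ perfect_power k m.
Proof.
move=> pr_k m_gt0; split=> [[d Ed]|[/dvdnP[q ->]|[d ->]]]; last 2 first.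
- by exists (m ^ q)%N; rewrite expnM.
- by exists (d ^ a)%N; rewrite -!expnM mulnC.
have [ka|nka] := boolP (k %| a)%N; [by left|right].
have a_gt0 : (0 < a)%N by case: a nka {Ed}; rewrite ?dvdn0.
case: (egcdnP k a_gt0) => u v Euv _.
have co : gcdn a k = 1%N.
  by apply/eqP; rewrite -/(coprime _ _) coprime_sym prime_coprime.
have E : (m * (m ^ v) ^ k = (d ^ u) ^ k)%N.
  rewrite -[((m ^ v) ^ k)%N]expnM -expnS -addn1 -co -Euv mulnC expnM Ed.
  by rewrite -!expnM mulnC.
have : (m ^ v %| d ^ u)%N.
  by rewrite -(@dvdn_pexp2r _ _ k) ?prime_gt0 // -E dvdn_mull.
case/dvdnP=> q Eq; exists q; apply/eqP; move/eqP: E.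
by rewrite Eq expnMn eqn_pmul2r // !expn_gt0 m_gt0.
Qed.

Lemma perfect_cubeP (a : int) :
  perfect_power 3 `|a| <-> exists e, a = e ^+ 3.
Proof.
split=> [[d Ed]|[e ->]]; last by exists `|e|%N; rewrite abszX.
have [a_ge0|a_lt0] := leP 0 a.
  by exists d%:Z; rewrite -(gez0_abs a_ge0) Ed; lia.
by exists (- d%:Z); rewrite -[a]opprK -(ltz0_abs a_lt0) Ed; lia.
Qed.

Lemma is_pm_squareP (R : numDomainType) (m : int) : m != 0 ->
  is_pm_square (m%:~R : R) <-> perfect_power 2 `|m|.
Proof.
move=> m_neq0; split=> [[k _ Ek]|[d Ed]].
  have [->|->] : m = k ^+ 2 \/ m = - k ^+ 2.
    by case: Ek => /intr_inj->; [left | right].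
  - by exists `|k|%N; rewrite abszX.
  - by exists `|k|%N; rewrite abszN abszX.
exists d%:Z.
  move: m_neq0; apply: contra_neq => d0; move: Ed.
  by rewrite (_ : d = 0%N); lia.
have [m_ge0|m_lt0] := leP 0 m; [left | right]; congr (_%:~R); lia.
Qed.

Lemma is_cubeP (R : numDomainType) (m : int) : m != 0 ->
  is_cube (m%:~R : R) <-> perfect_power 3 `|m|.
Proof.
rewrite perfect_cubeP => m_neq0; split=> [[k _ /intr_inj->]|[e Ee]].
  by exists k.
exists e; rewrite ?Ee //.
by apply: contraNneq m_neq0 => e0; rewrite Ee e0 expr0n.
Qed.

Lemma coprime_cubes (a b c : int) : coprimez a b -> a * b = c ^+ 3 ->
  (exists e, a = e ^+ 3) /\ (exists e, b = e ^+ 3).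
Proof.
move=> co_ab Ec; rewrite -!perfect_cubeP -perfect_power_coprimeM //.
by rewrite -abszM Ec abszX; exists `|c|%N.
Qed.

(** * Cubes of the form a^2 + 3 b^2 *)

Lemma int_mod2 (w : int) : exists w', w = 2 * w' \/ w = 2 * w' + 1.
Proof. by exists (w %/ 2)%Z; lia. Qed.

Lemma int_mod3 (w : int) :
  exists w', w = 3 * w' \/ w = 3 * w' + 1 \/ w = 3 * w' + 2.
Proof. by exists (w %/ 3)%Z; lia. Qed.

Lemma norm_form_gt0 (u v : int) :
  (u != 0) || (v != 0) -> 0 < u ^+ 2 + 3 * v ^+ 2.
Proof.
have v_ge0 := sqr_ge0 v; case/orP=> nz.
  by apply: ltr_wpDr; [rewrite mulr_ge0 | rewrite exprn_even_gt0].
by apply: ltr_wpDl; [exact: sqr_ge0 | rewrite mulr_gt0 // exprn_even_gt0].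
Qed.

Lemma norm_form_mod4 (u v d : int) :
  u ^+ 2 + 3 * v ^+ 2 <> 2 * (2 * d + 1).
Proof.
have [u' [->|->]] := int_mod2 u; have [v' [->|->]] := int_mod2 v;
  rewrite !expr2; lia.
Qed.

Lemma norm_form_dvd3 (u v d : int) :
  u ^+ 2 + 3 * v ^+ 2 = 3 * d -> exists w, u = 3 * w.
Proof.
have [w [->|[->|->]]] := int_mod3 u; first by exists w.
- by rewrite !expr2; lia.
- by rewrite !expr2; lia.
Qed.

Lemma norm_form1 (s t : int) :
  s ^+ 2 + 3 * t ^+ 2 = 1 -> t = 0 /\ (s = 1 \/ s = -1).
Proof. by rewrite !expr2 => E; split; nia. Qed.

Lemma absz_norm_form_gt1 (p q : int) :
  q != 0 -> (1 < `|(p ^+ 2 + 3 * q ^+ 2)%R|)%N.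
Proof.
move=> q0; have := sqr_ge0 p; have : 0 < q ^+ 2 by rewrite exprn_even_gt0.
by rewrite !expr2; lia.
Qed.

Lemma coprimez_norm_form (a b : int) :
  coprimez a b -> coprimez b (a ^+ 2 + 3 * b ^+ 2).
Proof.
move=> co_ab; rewrite /coprimez addrC expr2 mulrA gcdzMDl -/(coprimez _ _).
by rewrite coprimezXr // coprimez_sym.
Qed.

(** Thue's lemma, by the pigeonhole principle: two of the [(A+1)(B+1) > d]
    differences [i - r j] agree modulo [d]. *)
Lemma thue (d A B : nat) (r : int) : (0 < d)%N -> (d < A.+1 * B.+1)%N ->
  exists u v : int, [/\ (u != 0) || (v != 0), (`|u| <= A)%N, (`|v| <= B)%N
    & (d %| u - r * v)%Z].
Proof.
case: d => // d _ lt_d.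
pose g (ij : 'I_A.+1 * 'I_B.+1) : int := (ij.1 : nat)%:Z - r * (ij.2 : nat)%:Z.
pose f ij : 'I_d.+1 := inord `|(g ij %% d.+1)%Z|%N.
have /injectivePn[[i1 j1] [[i2 j2] neq eq_f]] : ~~ injectiveb f.
  apply/injectiveP => inj_f; have := leq_card f inj_f.
  by rewrite card_prod !card_ord leqNgt lt_d.
have eq_g : (g (i1, j1) = g (i2, j2) %[mod d.+1])%Z.
  have mod_bd m : (0 <= (m %% d.+1)%Z) /\ ((m %% d.+1)%Z < d.+1).
    by rewrite modz_ge0 // ltz_pmod.
  have [ge0 lt1] := mod_bd (g (i1, j1)); have [ge0' lt2] := mod_bd (g (i2, j2)).
  by have := congr1 val eq_f; rewrite /= !inordK; lia.
exists ((i1 : nat)%:Z - (i2 : nat)%:Z), ((j1 : nat)%:Z - (j2 : nat)%:Z); split.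
- move: neq; rewrite xpair_eqE -!val_eqE /=; lia.
- have := ltn_ord i1; have := ltn_ord i2; lia.
- have := ltn_ord j1; have := ltn_ord j2; lia.
move/eqP: eq_g; rewrite eqz_mod_dvd /g /=.
by congr (_ %| _)%Z; ring.
Qed.

(** The ideal of [Z[sqrt(-3)]] generated by [d] and [r + sqrt(-3)] is
    principal, with a generator of norm [d].  A short element
    [u + v sqrt(-3)] provided by Thue's lemma has norm [e d] with [0 < e < 4];
    [e = 2] is impossible modulo 4, and for [e = 3] the element is divisible
    by [sqrt(-3)]. *)
Lemma norm_form_generator (d : nat) (r : int) : odd d -> coprime d 3 ->
  (d %| r ^+ 2 + 3)%Z ->
  exists p q : int, d%:Z = p ^+ 2 + 3 * q ^+ 2 /\ (d %| p - r * q)%Z.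
Proof.
move=> odd_d co_d3 dvd_r.
have d_gt0 : (0 < d)%N by case: d odd_d {co_d3 dvd_r}.
have [u [v [nz lt4 ndvd]]] : exists u v : int, [/\ (u != 0) || (v != 0),
    u ^+ 2 + 3 * v ^+ 2 < 4 * d%:Z & (d %| u - r * v)%Z].
  have [k le_kd lt_dk] : exists2 k, (k * k <= d)%N & (d < k.+1 * k.+1)%N.
    elim: (d) => [|m [k le_km lt_mk]]; first by exists 0%N.
    have [ge|lt] := leqP (k.+1 * k.+1)%N m.+1; [exists k.+1|exists k] => //.
      by rewrite mulSn mulnS; lia.
    by lia.
  have sqr_le (w : int) A : (`|w| <= A)%N -> w ^+ 2 <= (A * A)%N.
    by move=> le_wA; rewrite expr2; nia.
  have [eq_kd|ne_kd] := eqVneq (k * k)%N d; last first.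
    have [//|u [v [nz /sqr_le le_u /sqr_le le_v ndvd]]] := @thue d k k r d_gt0.
    by exists u, v; split=> //; lia.
  (* for a square [d = k^2], the square box only gives [4 d]: use a smaller
     bound on [v] to keep the inequality strict *)
  case: k eq_kd {le_kd lt_dk} => [|k] eq_kd.
    by move: d_gt0; rewrite -eq_kd.
  have [||u [v [nz /sqr_le le_u /sqr_le le_v ndvd]]] := @thue d k.+1 k r.
  - by [].
  - by rewrite -eq_kd ltn_pmul2r.
  by exists u, v; split=> //; move: le_u le_v; rewrite -eq_kd !mulSn mulnS; lia.
have /dvdzP[m Em] := ndvd; have /dvdzP[n En] := dvd_r.
have [e Ee] : exists e, u ^+ 2 + 3 * v ^+ 2 = e * d%:Z.
  exists (m * (u + r * v) + n * v ^+ 2).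
  have -> : u ^+ 2 + 3 * v ^+ 2
    = (u - r * v) * (u + r * v) + (r ^+ 2 + 3) * v ^+ 2 by ring.
  by rewrite Em En; ring.
have dz_gt0 : 0 < d%:Z by [].
have e_bd : 0 < e < 4.
  by rewrite -(pmulr_lgt0 e dz_gt0) -(ltr_pM2r dz_gt0 e) -Ee lt4 norm_form_gt0.
have [e1|[e2|e3]] : e = 1 \/ e = 2 \/ e = 3 by clear -e_bd; lia.
- by exists u, v; rewrite Ee e1 mul1r.
- have Ed : d%:Z = 2 * d./2%:Z + 1 by clear -odd_d; lia.
  by case: (@norm_form_mod4 u v d./2); rewrite Ee e2 Ed.
have [w Ew] : exists w, u = 3 * w.
  by apply: (@norm_form_dvd3 u v d); rewrite Ee e3.
exists v, (- w); split.
  by move: Ee; rewrite sqrrN e3 Ew !expr2; clear; lia.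
rewrite -(@Gauss_dvdzr d 3 (v - r * - w)) //.
apply/dvdzP; exists (n * v + m * r).
have -> : 3 * (v - r * - w) = (r ^+ 2 + 3) * v + r * (3 * w - r * v) by ring.
by rewrite -Ew Em En; ring.
Qed.

(** Let [r = a / b] modulo [d^3], a square root of [-3], and let
    [p + q sqrt(-3)] be the element of norm [d] attached to [r].  Its cube
    [P + Q sqrt(-3)] satisfies [P = r Q] modulo [d^3], hence divides
    [a + b sqrt(-3)]; both have norm [d^3], so the quotient
    [s + t sqrt(-3)] is a unit, that is, 1 or -1. *)
Lemma norm_form_cube_odd (a b : int) (d : nat) :
  odd d -> coprime d 3 -> coprimez b d ->
  a ^+ 2 + 3 * b ^+ 2 = (d ^ 3)%N ->
  exists p q : int,
    [/\ a = p * (p ^+ 2 - 9 * q ^+ 2), b = 3 * q * (p ^+ 2 - q ^+ 2)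
      & d%:Z = p ^+ 2 + 3 * q ^+ 2].
Proof.
move=> odd_d co_d3 co_bd Ed.
set D := d%:Z ^+ 3; have {}Ed : a ^+ 2 + 3 * b ^+ 2 = D by rewrite Ed /D; lia.
have D_neq0 : D != 0 by rewrite /D expf_neq0 //; case: (d) odd_d.
have [[u v] /= Euv] : exists uv : int * int, uv.1 * b + uv.2 * D = 1.
  by apply/coprimezP; rewrite coprimezXr.
have Eub : u * b = 1 - v * D by rewrite -Euv addrK.
set r := u * a.
have [m Em] : exists m, a = r * b + m * D.
  by exists (a * v); rewrite /r -[LHS]mulr1 -Euv; ring.
have [n En] : exists n, r ^+ 2 + 3 = n * D.
  exists (u ^+ 2 + 6 * v + - 3 * v ^+ 2 * D); apply/eqP; rewrite -subr_eq0.
  have -> : r ^+ 2 + 3 - (u ^+ 2 + 6 * v + - 3 * v ^+ 2 * D) * D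
    = 3 * ((1 - v * D) ^+ 2 - (u * b) ^+ 2)
      + u ^+ 2 * (a ^+ 2 + 3 * b ^+ 2 - D) by rewrite /r; ring.
  by rewrite Eub Ed !subrr !mulr0.
have [|p [q [Epq /dvdzP[k Ek]]]] := @norm_form_generator d r odd_d co_d3.
  by rewrite En /D exprS; apply/dvdzP; exists (n * d%:Z ^+ 2); ring.
set P := p * (p ^+ 2 - 9 * q ^+ 2); set Q := 3 * q * (p ^+ 2 - q ^+ 2).
have ED : D = P ^+ 2 + 3 * Q ^+ 2 by rewrite /D Epq /P /Q; ring.
have [w Ew] : exists w, P - r * Q = w * D.
  exists (k ^+ 3 + n * (r * q ^+ 3 - 3 * p * q ^+ 2)).
  have -> : P - r * Q
    = (p - r * q) ^+ 3 + (r ^+ 2 + 3) * (r * q ^+ 3 - 3 * p * q ^+ 2).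
    by rewrite /P /Q; ring.
  by rewrite Ek En /D; ring.
(* [D (s + t sqrt(-3))] is [a + b sqrt(-3)] times the conjugate of
   [P + Q sqrt(-3)] *)
have [t Et] : exists t, b * P - a * Q = t * D.
  exists (b * w - m * Q); rewrite Em.
  have -> : b * P - (r * b + m * D) * Q = b * (P - r * Q) - m * D * Q by ring.
  by rewrite Ew; ring.
have [s Es] : exists s, a * P + 3 * b * Q = s * D.
  exists (b * (r * w + n * Q) + m * P); rewrite Em.
  have -> : (r * b + m * D) * P + 3 * b * Q
    = b * (r * (P - r * Q) + (r ^+ 2 + 3) * Q) + m * D * P by ring.
  by rewrite Ew En; ring.
have Est : s ^+ 2 + 3 * t ^+ 2 = 1.
  apply: (mulIf (expf_neq0 2 D_neq0)).
  have -> : (s ^+ 2 + 3 * t ^+ 2) * D ^+ 2 = (s * D) ^+ 2 + 3 * (t * D) ^+ 2.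
    by ring.
  rewrite -Es -Et mul1r [RHS]expr2 -{1}Ed ED; ring.
have Ea : a = s * P - 3 * t * Q.
  apply: (mulIf D_neq0); rewrite mulrBl mulrAC -Es.
  have -> : 3 * t * Q * D = 3 * Q * (t * D) by ring.
  by rewrite -Et ED; ring.
have Eb : b = s * Q + t * P.
  apply: (mulIf D_neq0); rewrite mulrDl mulrAC [t * P * D]mulrAC -Es -Et ED.
  by ring.
have [t0 [s1|s1]] := norm_form1 Est.
  by exists p, q; rewrite Ea Eb t0 s1 -Epq; split; rewrite ?/P ?/Q; ring.
exists (- p), (- q); rewrite Ea Eb t0 s1 !sqrrN -Epq.
by split; rewrite ?/P ?/Q; ring.
Qed.

(** Euler's lemma on [a^2 + 3 b^2 = g^3]: the parity of [a + b] makes [g]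
    odd, and the coprimality conditions pass from [a], [b] to [g]. *)
Lemma norm_form_cube (a b n g : int) :
  coprimez a b -> coprimez a 3 -> a + b = 2 * n + 1 ->
  a ^+ 2 + 3 * b ^+ 2 = g ^+ 3 ->
  exists p q : int,
    [/\ a = p * (p ^+ 2 - 9 * q ^+ 2), b = 3 * q * (p ^+ 2 - q ^+ 2)
      & g = p ^+ 2 + 3 * q ^+ 2].
Proof.
move=> co_ab co_a3 odd_ab Eg.
have g_ge0 : 0 <= g.
  rewrite -(@exprn_odd_ge0 _ 3) // -Eg addr_ge0 ?sqr_ge0 //.
  by rewrite mulr_ge0 ?sqr_ge0.
have Ed := gez0_abs g_ge0; set d := `|g|%N in Ed; rewrite -Ed in Eg *.
have co_g (k : int) : coprimez k (a ^+ 2 + 3 * b ^+ 2) -> coprimez k d.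
  by rewrite Eg coprimez_pexpr.
apply: norm_form_cube_odd.
- apply: contraT => even_d.
  have Ed2 : d%:Z = 2 * d./2%:Z by clear -even_d; lia.
  have Ea : a = 2 * n + 1 - b by rewrite -odd_ab addrK.
  by move: Eg; rewrite Ea Ed2; clear; rewrite exprS !expr2; lia.
- rewrite coprime_sym; apply: (co_g 3).
  have -> : a ^+ 2 + 3 * b ^+ 2 = b ^+ 2 * 3 + a ^+ 2 by ring.
  by rewrite /coprimez gcdzMDl -/(coprimez _ _) coprimezXr // coprimez_sym.
- exact/co_g/coprimez_norm_form.
- by rewrite Eg; lia.
Qed.

(** * The equation x^3 + y^3 = 2 z^3 *)

(** [s], [s - t], [s + t] are pairwise coprime, the last two because they are
    odd; the resulting cubes satisfy [g^3 + h^3 = 2 f^3]. *)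
Lemma three_cubes (s t n e : int) : coprimez s t -> s + t = 2 * n + 1 ->
  s * (s ^+ 2 - t ^+ 2) = e ^+ 3 ->
  exists f g h, [/\ s = f ^+ 3, s - t = g ^+ 3, s + t = h ^+ 3 & coprimez g h].
Proof.
move=> co_st odd_st Ee.
have co_s : coprimez s (s ^+ 2 - t ^+ 2).
  by rewrite expr2 /coprimez gcdzMDl -/(coprimez _ _) coprimezN coprimezXr.
have co_mp : coprimez (s - t) (s + t).
  have [[u v] /= Euv] := coprimezP _ _ co_st.
  apply/coprimezP; exists (- n * (u - v), 1 - n * (u + v)) => /=.
  have -> : - n * (u - v) * (s - t) + (1 - n * (u + v)) * (s + t)
    = s + t - 2 * n * (u * s + v * t) by ring.
  by rewrite Euv odd_st; ring.
have [[f Ef] [w Ew]] := coprime_cubes co_s Ee.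
have [[g Eg] [h Eh]] : (exists g, s - t = g ^+ 3) /\ exists h, s + t = h ^+ 3.
  by apply: (@coprime_cubes _ _ w); rewrite // -Ew; ring.
exists f, g, h; split=> //.
by move: co_mp; rewrite Eg Eh coprimez_pexpl // coprimez_pexpr.
Qed.

(** One step of the descent: the cubes of [three_cubes] give a solution
    [g^3 + h^3 = 2 f^3] with [s = f^3] a proper divisor of [z^3], so that [f]
    is smaller than [z]. *)
Lemma descent_step (N : nat) (s t n e z k d : int) :
  (forall x y z', (`|z'| < N)%N -> coprimez x y ->
     x ^+ 3 + y ^+ 3 = 2 * z' ^+ 3 -> x = y \/ z' = 0) ->
  coprimez s t -> s + t = 2 * n + 1 -> s * (s ^+ 2 - t ^+ 2) = e ^+ 3 ->
  z ^+ 3 = s * (k * d ^+ 3) -> z != 0 -> (`|z| <= N)%N ->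
  (t != 0 -> (1 < `|d|)%N) ->
  t = 0.
Proof.
move=> IH co_st odd_st Ee Ez z_neq0 le_zN d_gt1.
have [f [g [h [Ef Eg Eh co_gh]]]] := three_cubes co_st odd_st Ee.
have [//|t_neq0] := eqVneq t 0; have {}d_gt1 := d_gt1 t_neq0.
have m_neq0 : k * d ^+ 3 != 0.
  by apply: contraNneq z_neq0 => m0; move/eqP: Ez; rewrite m0 mulr0 expf_eq0.
have m_gt1 : (1 < `|(k * d ^+ 3)%R|)%N.
  rewrite abszM abszX; apply: (@leq_trans (1 * `|d| ^ 3)%N).
    by rewrite mul1n -[1%N](exp1n 3) ltn_exp2r.
  rewrite leq_mul2r absz_gt0; move: m_neq0.
  by rewrite mulf_eq0 => /norP[-> _]; rewrite orbT.
have f_neq0 : f != 0.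
  apply: contraNneq z_neq0 => f0; move/eqP: Ez.
  by rewrite Ef f0 expr0n mul0r expf_eq0.
have lt_fz : (`|f| < `|z|)%N.
  rewrite -(@ltn_exp2r _ _ 3) // -!abszX Ez Ef abszM ltn_Pmulr //.
  by rewrite absz_gt0 expf_neq0.
have [|E|f0] := IH g h f (leq_trans lt_fz le_zN) co_gh.
- by rewrite -Eg -Eh -Ef; ring.
- by move: Eg Eh; rewrite E => <- E2; clear -E2; lia.
- by rewrite f0 in f_neq0.
Qed.

Lemma coprime_same_parity (x y z : int) :
  coprimez x y -> x ^+ 3 + y ^+ 3 = 2 * z ->
  exists a b n, [/\ x = a + b, y = a - b, a + b = 2 * n + 1 & coprimez a b].
Proof.
move=> co_xy Exy.
have [u [v Euv]] : exists u v, u * x + v * y = 1.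
  by have [[u v] Euv] := coprimezP _ _ co_xy; exists u, v.
have [a [b [n [Ex Ey En]]]] :
    exists a b n, [/\ x = a + b, y = a - b & a + b = 2 * n + 1].
  have [x' Ex] := int_mod2 x; have [y' Ey] := int_mod2 y.
  case: Ex Exy Euv => [->|->]; case: Ey => [->|->] Exy Euv.
  - by exfalso; have : 2 * (u * x' + v * y') = 1;
      [rewrite -[RHS]Euv; ring | clear; lia].
  - by exfalso; move: Exy; clear; rewrite !exprS !expr0; lia.
  - by exfalso; move: Exy; clear; rewrite !exprS !expr0; lia.
  by exists (x' + y' + 1), (x' - y'), x'; split; ring.
exists a, b, n; split=> //; apply/coprimezP; exists (u + v, u - v) => /=.
by rewrite -Euv Ex Ey; ring.
Qed.

Lemma cube_root_coprime (p q n : int) :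
  let a := p * (p ^+ 2 - 9 * q ^+ 2) in let b := 3 * q * (p ^+ 2 - q ^+ 2) in
  coprimez a b -> a + b = 2 * n + 1 ->
  coprimez p (3 * q) /\ exists n', p + q = 2 * n' + 1.
Proof.
move=> a b; rewrite /a /b coprimezMl coprimezMr.
move=> /andP[/andP[co_pq _] _] odd_ab; split=> //; move: odd_ab; clear.
have [p' [->|->]] := int_mod2 p; have [q' [->|->]] := int_mod2 q.
- by rewrite !expr2; lia.
- by exists (p' + q'); ring.
- by exists (p' + q'); ring.
- by rewrite !expr2; lia.
Qed.

Lemma coprimez3 (a w : int) : a = 3 * w + 1 \/ a = 3 * w + 2 -> coprimez a 3.
Proof.
by case=> ->; apply/coprimezP; [exists (1, - w) | exists (- 1, w + 1)];
  rewrite /=; ring.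
Qed.

Lemma cube_dvd3 (z k : int) : z ^+ 3 = 3 * k -> exists w, z = 3 * w.
Proof.
have [w [->|[->|->]]] := int_mod3 z; first by exists w.
- by rewrite !exprS expr0; lia.
- by rewrite !exprS expr0; lia.
Qed.

(** Euler's theorem.  With [x = a + b] and [y = a - b] the equation reads
    [a (a^2 + 3 b^2) = z^3].  If 3 does not divide [a], the two factors are
    coprime cubes, and writing the second one as in [norm_form_cube] gives
    [a = p (p - 3q) (p + 3q)].  If [a = 3c], then [c = 3g] and
    [g (b^2 + 3 c^2)] is a cube; the same argument, with [b] and [c] in place
    of [a] and [b], gives [g = q (p - q) (p + q)].  In both cases
    [descent_step] applies. *)
Lemma sum_cubes_eq_double_cube (x y z : int) :
  coprimez x y -> x ^+ 3 + y ^+ 3 = 2 * z ^+ 3 -> x = y \/ z = 0.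
Proof.
have [N] := ubnP `|z|%N; elim: N => // N IH in x y z *; rewrite ltnS => le_zN.
move=> co_xy Exyz.
have [z0|z_neq0] := eqVneq z 0; [by right | left].
have [a [b [n [Ex Ey odd_ab co_ab]]]] := coprime_same_parity co_xy Exyz.
suff b0 : b = 0 by rewrite Ex Ey b0 oppr0.
have Ez : a * (a ^+ 2 + 3 * b ^+ 2) = z ^+ 3.
  by apply: (@mulfI _ 2) => //; rewrite -Exyz Ex Ey; ring.
have [c [Ea|/coprimez3 co_a3]] := int_mod3 a; last first.
  have co_a : coprimez a (a ^+ 2 + 3 * b ^+ 2).
    rewrite /coprimez expr2 gcdzMDl -/(coprimez _ _).
    by rewrite coprimezMr co_a3 coprimezXr.
  have [[e Ee] [d Ed]] := coprime_cubes co_a Ez.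
  have [p [q [Ea Eb Edpq]]] := norm_form_cube co_ab co_a3 odd_ab Ed.
  rewrite Ea Eb in co_ab odd_ab.
  have [co_pq [n' odd_pq]] := cube_root_coprime co_ab odd_ab.
  suff q0 : 3 * q = 0 by rewrite Eb q0 mul0r.
  apply: (@descent_step N p (3 * q) (n' + q) e z (p ^+ 2 - 9 * q ^+ 2) d) => //.
  - by rewrite mulrDr addrAC -odd_pq; ring.
  - by rewrite -Ee Ea; ring.
  - by rewrite -Ez Ed Ea; ring.
  by rewrite mulf_eq0 /= => q_neq0; rewrite Edpq absz_norm_form_gt1.
have co_b3 : coprimez b 3.
  by move: co_ab; rewrite Ea coprimezMl coprimez_sym => /andP[].
have co_bc : coprimez b c.
  by move: co_ab; rewrite Ea coprimezMl ![coprimez _ b]coprimez_sym => /andP[].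
have [z' Ez'] : exists z', z = 3 * z'.
  apply: (@cube_dvd3 z (3 * c * (b ^+ 2 + 3 * c ^+ 2))).
  by rewrite -Ez Ea; ring.
have Ec : c * (b ^+ 2 + 3 * c ^+ 2) = 3 * z' ^+ 3.
  apply: (@mulfI _ 9) => //.
  by transitivity (z ^+ 3); [rewrite -Ez Ea | rewrite Ez']; ring.
have [g Eg] : exists g, c = 3 * g.
  have : (3 %| c * b ^+ 2)%Z.
    apply/dvdzP; exists (z' ^+ 3 - c ^+ 3).
    by rewrite mulrBl [z' ^+ 3 * 3]mulrC -Ec; ring.
  rewrite Gauss_dvdzl; last by rewrite coprimezXr // coprimez_sym.
  by case/dvdzP=> g ->; exists g; rewrite mulrC.
have {}Ez : g * (b ^+ 2 + 3 * c ^+ 2) = z' ^+ 3.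
  by apply: (@mulfI _ 3) => //; rewrite -Ec mulrA -Eg.
have co_g : coprimez g (b ^+ 2 + 3 * c ^+ 2).
  by have := coprimez_norm_form co_bc; rewrite {1}Eg coprimezMl => /andP[].
have [[e Ee] [d Ed]] := coprime_cubes co_g Ez.
have odd_bc : b + c = 2 * (n - c) + 1.
  by rewrite mulrBr addrAC -odd_ab Ea; ring.
have [p [q [Eb Ecq Edpq]]] := norm_form_cube co_bc co_b3 odd_bc Ed.
rewrite Eb Ecq in co_bc odd_bc.
have [] := cube_root_coprime co_bc odd_bc.
rewrite coprimezMr => /andP[_ co_pq] [n' odd_pq].
have {Ecq}Eg' : g = q * (p ^+ 2 - q ^+ 2).
  by apply: (@mulfI _ 3) => //; rewrite -Eg Ecq mulrA.
have q_neq0 : q != 0.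
  apply: contraNneq z_neq0 => q0; rewrite Ez'; move/eqP: Ez.
  by rewrite Eg' q0 !mul0r eq_sym expf_eq0 => /andP[_ /eqP->]; rewrite mulr0.
suff p0 : p = 0 by rewrite Eb p0 mul0r.
apply: (@descent_step N q p n' (- e) z (27 * (p ^+ 2 - q ^+ 2)) d) => //.
- by rewrite coprimez_sym.
- by rewrite addrC.
- by rewrite exprNn -Ee Eg'; ring.
- by rewrite Ez' exprMn -Ez Ed Eg'; ring.
by rewrite Edpq absz_norm_form_gt1.
Qed.

(** * Perfect powers among m, m - 1 and 2 m - 1 *)

Lemma squares_m_pred (m : int) :
  m != 0 -> m != 1 ->
  perfect_power 2 `|m| -> ~ perfect_power 2 `|(m - 1)%R|.
Proof.
move=> m0 m1 [u Eu] [v Ev].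
have u_gt0 : (0 < u)%N by case: u Eu; lia.
have v_gt0 : (0 < v)%N by case: v Ev; lia.
have : (u ^ 2 = v ^ 2 + 1 \/ v ^ 2 = u ^ 2 + 1 \/ u ^ 2 + v ^ 2 = 1)%N.
  by rewrite -Eu -Ev; clear -m0 m1; lia.
rewrite -!mulnn; have := leq_mul u_gt0 u_gt0; have := leq_mul v_gt0 v_gt0.
have [[le|lt] [le'|lt']] := (leqP u v, leqP v u).
- have := leq_mul le le; have := leq_mul le' le'; lia.
- have := leq_mul lt' lt'; lia.
- have := leq_mul lt lt; lia.
- lia.
Qed.

Lemma consecutive_cubes (u v : int) : u ^+ 3 - v ^+ 3 = 1 -> u = 0 \/ v = 0.
Proof.
move=> E; have E' : (u - v) * (u ^+ 2 + u * v + v ^+ 2) = 1 by rewrite -E; ring.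
have [k Ek] : exists k, u = v + k by exists (u - v); ring.
have [k1|k1] : k = 1 \/ k = -1.
- have : (k %| 1)%Z.
    apply/dvdzP; exists (u ^+ 2 + u * v + v ^+ 2).
    by apply: etrans (esym E') _; rewrite Ek; ring.
  by rewrite dvdz1; clear; lia.
- move: E; rewrite Ek k1 !exprS !expr0; clear; nia.
- move: E; rewrite Ek k1 !exprS !expr0; clear; lia.
Qed.

Lemma cubes_m_pred (m : int) :
  m != 0 -> m != 1 ->
  perfect_power 3 `|m| -> ~ perfect_power 3 `|(m - 1)%R|.
Proof.
move=> m0 m1 /perfect_cubeP[u Eu] /perfect_cubeP[v Ev].
have [|u0|v0] := @consecutive_cubes u v.
- by rewrite -Eu -Ev; ring.
- by move: m0; rewrite Eu u0 expr0n.
- by move: m1; rewrite -subr_eq0 Ev v0 expr0n.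
Qed.

(** [m = u^3] and [2 m - 1 = v^3] give [v^3 + 1^3 = 2 u^3]. *)
Lemma cubes_m_double_pred (m : int) :
  m != 0 -> m != 1 ->
  perfect_power 3 `|m| -> ~ perfect_power 3 `|(2 * m - 1)%R|.
Proof.
move=> m0 m1 /perfect_cubeP[u Eu] /perfect_cubeP[v Ev].
have [||v1|u0] := @sum_cubes_eq_double_cube v 1 u.
- by rewrite coprimezE coprimen1.
- by rewrite -Ev -Eu; ring.
- by move: m1 Ev; rewrite v1 expr1n; clear; lia.
- by move: m0; rewrite Eu u0 expr0n.
Qed.

(** The involution [m -> 1 - m] exchanges [m] and [m - 1] up to sign and
    changes the sign of [2 m - 1]. *)
Lemma cubes_pred_double_pred (m : int) :
  m != 0 -> m != 1 ->
  perfect_power 3 `|(m - 1)%R| -> ~ perfect_power 3 `|(2 * m - 1)%R|.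
Proof.
move=> m0 m1; rewrite -abszN -[`|(2 * m - 1)%R|%N]abszN.
have -> : - (m - 1) = 1 - m by ring.
have -> : - (2 * m - 1) = 2 * (1 - m) - 1 by ring.
by apply: cubes_m_double_pred; move: m0 m1; clear; lia.
Qed.

Definition monomial3 (m : int) (abc : nat * nat * nat) : nat :=
  (`|m| ^ abc.1.1 * `|(m - 1)%R| ^ abc.1.2 * `|(2 * m - 1)%R| ^ abc.2)%N.

Lemma perfect_power_monomial p (m : int) abc : prime p -> m != 0 -> m != 1 ->
  perfect_power p (monomial3 m abc) <->
  ((p %| abc.1.1)%N \/ perfect_power p `|m|)
  /\ ((p %| abc.1.2)%N \/ perfect_power p `|(m - 1)%R|)
  /\ ((p %| abc.2)%N \/ perfect_power p `|(2 * m - 1)%R|).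
Proof.
move=> pr_p m0 m1; rewrite /monomial3.
have co_xy : coprimez m (m - 1) by apply/coprimezP; exists (1, -1) => /=; ring.
have co_xz : coprimez m (2 * m - 1).
  by apply/coprimezP; exists (2, -1) => /=; ring.
have co_yz : coprimez (m - 1) (2 * m - 1).
  by apply/coprimezP; exists (-2, 1) => /=; ring.
rewrite !coprimezE in co_xy co_xz co_yz.
rewrite !perfect_power_coprimeM ?coprimeMl ?coprimeXl ?coprimeXr //.
rewrite !perfect_power_exp ?absz_gt0 //.
- by split=> [[[? ?] ?]|[? [? ?]]].
- by clear; lia.
- by move: m1; clear; lia.
Qed.

Lemma monomial_is_pm_square (al m : int) abc :
  al != 0 -> al != 1 -> m != 0 -> `|m|%N = monomial3 al abc ->
  is_pm_square (m%:~R : rat) <->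
  ((2 %| abc.1.1)%N \/ perfect_power 2 `|al|)
  /\ ((2 %| abc.1.2)%N \/ perfect_power 2 `|(al - 1)%R|)
  /\ ((2 %| abc.2)%N \/ perfect_power 2 `|(2 * al - 1)%R|).
Proof.
move=> al0 al1 m0 Em; apply: iff_trans (is_pm_squareP rat m0) _.
by rewrite Em; apply: perfect_power_monomial.
Qed.

Lemma monomial_is_cube (al m : int) abc :
  al != 0 -> al != 1 -> m != 0 -> `|m|%N = monomial3 al abc ->
  is_cube (m%:~R : rat) <->
  ((3 %| abc.1.1)%N \/ perfect_power 3 `|al|)
  /\ ((3 %| abc.1.2)%N \/ perfect_power 3 `|(al - 1)%R|)
  /\ ((3 %| abc.2)%N \/ perfect_power 3 `|(2 * al - 1)%R|).
Proof.
move=> al0 al1 m0 Em; apply: iff_trans (is_cubeP rat m0) _.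
by rewrite Em; apply: perfect_power_monomial.
Qed.

(** * Elliptic divisibility sequences of rank 8 *)

(** An elliptic divisibility sequence with initial terms [0, 1, c2, c3, c4]
    vanishing at index 8 is symmetric and quasi-periodic:
    [e (8 - r) = t^(4 - r) e r] gives the terms 5, 6, 7, and the other ones
    follow from [e (8k + r) = (-1)^k t^(4k^2 + rk) e r]. *)
Definition eds8 (R : comNzRingType) (c2 c3 c4 t : R) (n : nat) : R :=
  (-1) ^+ (n %/ 8) * t ^+ (4 * (n %/ 8) ^ 2 + n %% 8 * (n %/ 8))
  * nth 0 [:: 0; 1; c2; c3; c4; t * c3; t ^+ 2 * c2; t ^+ 3] (n %% 8).

(** The recurrences that define the terms 5, 6 and 7, solved for the monomials
    in which [t] does not occur. *)
Definition eds8_compatible (R : comNzRingType) (c2 c3 c4 t : R) : Prop :=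
  [/\ c4 * c2 ^+ 3 = t * c3 + c3 ^+ 3,
      c3 * c4 ^+ 2 = t * c2 ^+ 2 * c3 ^+ 2 - t ^+ 2 * c2 ^+ 2
    & c2 * c4 ^+ 3 = t * c3 ^+ 4 - t ^+ 3].

(** The factor is also right for [r = 8q + s] outside the first period, as the
    exponent is quadratic in the block number:
    [4 (k + q)^2 + s (k + q) = (4 k^2 + r k) + (4 q^2 + s q)]. *)
Lemma eds8_shift (R : comNzRingType) (c2 c3 c4 t : R) k r :
  let e := eds8 c2 c3 c4 t in
  e (8 * k + r)%N = (-1) ^+ k * t ^+ (4 * k ^ 2 + r * k) * e r.
Proof.
rewrite /= /eds8 [(8 * k)%N]mulnC modnMDl divnMDl // exprD.
rewrite !mulrA; congr (_ * _); rewrite -!mulrA [t ^+ _ * (_ * _)]mulrCA.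
congr (_ * (_ * _)); rewrite -exprD; congr (_ ^+ _); have := divn_eq r 8.
move: (r %/ 8)%N (r %% 8)%N => q s ->; ring.
Qed.

(** Separates the part [t^(ki)] of the factor, so that in an expression
    homogeneous in the terms with indices [8k + j + i] all powers of [t] are
    powers of [t^(4k^2 + jk)] and [t^k]. *)
Lemma eds8_shiftD (R : comNzRingType) (c2 c3 c4 t : R) k j i :
  let e := eds8 c2 c3 c4 t in
  e (8 * k + (j + i))%N
  = (-1) ^+ k * t ^+ (4 * k ^ 2 + j * k) * (t ^+ k) ^+ i * e (j + i)%N.
Proof.
rewrite /= eds8_shift mulnDl addnA exprD [(i * k)%N]mulnC exprM.
by rewrite -!mulrA.
Qed.

Lemma eds8_shift_double (R : comNzRingType) (c2 c3 c4 t : R) k j i :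
  let e := eds8 c2 c3 c4 t in
  e (8 * k.*2 + (j.*2 + i))%N
  = (t ^+ (4 * k ^ 2 + j * k)) ^+ 4 * (t ^+ k) ^+ i.*2 * e (j.*2 + i)%N.
Proof.
rewrite /= eds8_shift -mul2n exprM sqrrN !expr1n mul1r.
by rewrite -!exprM -exprD; congr (t ^+ _ * _); rewrite -!mul2n; ring.
Qed.

(** The remainder is taken between 2 and 9 so that the indices occurring in
    the recurrences, the smallest being [n - 2], remain nonnegative when [8k]
    is subtracted. *)
Lemma window8 n : (2 <= n)%N ->
  exists k j, (n = 8 * k + (j + 2))%N /\ (j < 8)%N.
Proof. by move=> le2n; exists ((n - 2) %/ 8)%N, ((n - 2) %% 8)%N; lia. Qed.

Lemma window8_ind (P : nat -> Prop) :
  P 0 -> P 1 -> (forall k j, (j < 8)%N -> P (8 * k + (j + 2))%N) ->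
  forall n, P n.
Proof.
move=> P0 P1 Pkj [|[|n]] //.
by have [k [j [-> lt_j8]]] := window8 (isT : (2 <= n.+2)%N); apply: Pkj.
Qed.

Lemma eds8_odd (R : comNzRingType) (c2 c3 c4 t : R) n :
  eds8_compatible c2 c3 c4 t -> (2 <= n)%N ->
  let e := eds8 c2 c3 c4 t in
  e n.*2.+1 = e n.+2 * e n ^+ 3 - e n.-1 * e n.+1 ^+ 3.
Proof.
move=> [R5 R6 R7] /window8[k [j [-> lt_j8]]] e.
have -> : ((8 * k + (j + 2)).*2.+1 = 8 * k.*2 + (j.*2 + 5))%N by lia.
have -> : ((8 * k + (j + 2)).+2 = 8 * k + (j + 4))%N by lia.
have -> : ((8 * k + (j + 2)).-1 = 8 * k + (j + 1))%N by lia.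
have -> : ((8 * k + (j + 2)).+1 = 8 * k + (j + 3))%N by lia.
rewrite /e eds8_shift_double !eds8_shiftD -/e.
suff -> : e (j.*2 + 5)%N
    = e (j + 4)%N * e (j + 2)%N ^+ 3 - e (j + 1)%N * e (j + 3)%N ^+ 3.
  have := sqrr_sign R k.
  set s := (-1) ^+ k; set A := t ^+ _; set B := t ^+ k => s2.
  transitivity ((s ^+ 2) ^+ 2 * (A ^+ 4 * B ^+ 10
    * (e (j + 4)%N * e (j + 2)%N ^+ 3 - e (j + 1)%N * e (j + 3)%N ^+ 3))).
    by rewrite s2 expr1n mul1r.
  by ring.
case: j lt_j8 => [|[|[|[|[|[|[|[|//]]]]]]]] _; rewrite /e /eds8 ![nth _ _ _]/=.
(* the order of the rules decides which of two overlapping monomials is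
   rewritten *)
all: first [by ring: R5 R6 R7 | by ring: R7 R6 R5].
Qed.

Lemma eds8_even (R : comNzRingType) (c2 c3 c4 t : R) n :
  eds8_compatible c2 c3 c4 t -> (3 <= n)%N ->
  let e := eds8 c2 c3 c4 t in
  e n.*2 * e 2 = e n.-1 ^+ 2 * e n * e n.+2 - e n.-2 * e n * e n.+1 ^+ 2.
Proof.
move=> [R5 R6 R7] /ltnW/window8[k [j [-> lt_j8]]] e.
have -> : ((8 * k + (j + 2)).*2 = 8 * k.*2 + (j.*2 + 4))%N by lia.
have -> : ((8 * k + (j + 2)).+2 = 8 * k + (j + 4))%N by lia.
have -> : ((8 * k + (j + 2)).-2 = 8 * k + (j + 0))%N by lia.
have -> : ((8 * k + (j + 2)).-1 = 8 * k + (j + 1))%N by lia.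
have -> : ((8 * k + (j + 2)).+1 = 8 * k + (j + 3))%N by lia.
rewrite /e eds8_shift_double !eds8_shiftD -/e -mulrA.
suff -> : e (j.*2 + 4)%N * e 2 = e (j + 1)%N ^+ 2 * e (j + 2)%N * e (j + 4)%N
    - e (j + 0)%N * e (j + 2)%N * e (j + 3)%N ^+ 2.
  have := sqrr_sign R k.
  set s := (-1) ^+ k; set A := t ^+ _; set B := t ^+ k => s2.
  transitivity ((s ^+ 2) ^+ 2 * (A ^+ 4 * B ^+ 8
    * (e (j + 1)%N ^+ 2 * e (j + 2)%N * e (j + 4)%N
       - e (j + 0)%N * e (j + 2)%N * e (j + 3)%N ^+ 2))).
    by rewrite s2 expr1n mul1r.
  by ring.
case: j lt_j8 => [|[|[|[|[|[|[|[|//]]]]]]]] _; rewrite /e /eds8 ![nth _ _ _]/=.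
(* the order of the rules decides which of two overlapping monomials is
   rewritten *)
all: first [by ring: R5 R6 R7 | by ring: R7 R6 R5 | by ring: R6 R5 R7].
Qed.

Lemma eds8_phi (R : comNzRingType) (c2 c3 c4 t : R) k j :
  let e := eds8 c2 c3 c4 t in
  e (8 * k + (j + 3))%N * e (8 * k + (j + 1))%N
  = t ^+ (2 * (4 * k ^ 2 + (j + 2) * k)) * (e (j + 3)%N * e (j + 1)%N).
Proof.
move=> e; rewrite /e !eds8_shift -/e.
transitivity (((-1) ^+ k) ^+ 2 * (t ^+ (4 * k ^ 2 + (j + 3) * k)
  * t ^+ (4 * k ^ 2 + (j + 1) * k)) * (e (j + 3)%N * e (j + 1)%N)).
  by ring.
rewrite sqrr_sign mul1r -exprD.
by congr (t ^+ _ * _); ring.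
Qed.

(** [2 psi_2 omega_(i+2)] at the point [(0, 0)] of a curve with [a_1 = a]; there
    [psi_2] takes the value [a_3 = c2], and the factor of [a] is the value of
    [phi_(i+2)]. *)
Definition omega_form (R : comNzRingType) (c2 c3 c4 t a : R) (i : nat) : R :=
  let e := eds8 c2 c3 c4 t in
  e (i + 1)%N ^+ 2 * e (i + 4)%N - e (i + 0)%N * e (i + 3)%N ^+ 2
  - c2 * e (i + 2)%N
    * (a * - (e (i + 3)%N * e (i + 1)%N) + c2 * e (i + 2)%N ^+ 2).

Lemma eds8_omega (R : comNzRingType) (c2 c3 c4 t a : R) k j :
  omega_form c2 c3 c4 t a (8 * k + j)
  = (-1) ^+ k * t ^+ (3 * (4 * k ^ 2 + (j + 2) * k))
    * omega_form c2 c3 c4 t a j.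
Proof.
rewrite /omega_form -![(8 * k + j + _)%N]addnA !eds8_shiftD.
set e := eds8 c2 c3 c4 t.
have -> : t ^+ (3 * (4 * k ^ 2 + (j + 2) * k))
  = (t ^+ (4 * k ^ 2 + j * k)) ^+ 3 * (t ^+ k) ^+ 6.
  by rewrite -!exprM -exprD; congr (t ^+ _); ring.
have := sqrr_sign R k.
set s := (-1) ^+ k; set A := t ^+ _; set B := t ^+ k => s2.
transitivity (s ^+ 2 * (s * (A ^+ 3 * B ^+ 6)
  * (e (j + 1)%N ^+ 2 * e (j + 4)%N - e (j + 0)%N * e (j + 3)%N ^+ 2
     - c2 * e (j + 2)%N
       * (a * - (e (j + 3)%N * e (j + 1)%N) + c2 * e (j + 2)%N ^+ 2)))).
  by ring.
by rewrite s2 mul1r.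
Qed.

(** * Division polynomials at the point of order 8 *)

Lemma eval_atD p q x y : eval_at (p + q) x y = eval_at p x y + eval_at q x y.
Proof. by rewrite /eval_at !hornerD. Qed.

Lemma eval_atN p x y : eval_at (- p) x y = - eval_at p x y.
Proof. by rewrite /eval_at !hornerN. Qed.

Lemma eval_atM p q x y : eval_at (p * q) x y = eval_at p x y * eval_at q x y.
Proof. by rewrite /eval_at !hornerM. Qed.

Lemma eval_atX p n x y : eval_at (p ^+ n) x y = eval_at p x y ^+ n.
Proof. by rewrite /eval_at !horner_exp. Qed.

Lemma eval_at_nat n x y : eval_at n%:R x y = n%:R.
Proof. by rewrite /eval_at -polyC_natr hornerC -polyC_natr hornerC. Qed.

Lemma eval_at_cst c x y : eval_at (cst c) x y = c.
Proof. by rewrite /eval_at !hornerC. Qed.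

Lemma eval_at_varx x y : eval_at varx x y = x.
Proof. by rewrite /eval_at hornerC hornerX. Qed.

Lemma eval_at_vary x y : eval_at vary x y = y.
Proof. by rewrite /eval_at hornerX hornerC. Qed.

Definition eval_atE := (eval_atD, eval_atN, eval_atM, eval_atX, eval_at_nat,
  eval_at_cst, eval_at_varx, eval_at_vary).

(** Like the next three lemmas, stated for arbitrary polynomials because
    rewriting with [eval_atE] would unfold the division polynomials. *)
Lemma eval_at_odd_rec p q r s x y :
  eval_at (p * q ^+ 3 - r * s ^+ 3) x y
  = eval_at p x y * eval_at q x y ^+ 3 - eval_at r x y * eval_at s x y ^+ 3.
Proof. by rewrite !eval_atE. Qed.

Lemma eval_at_even_rec p q r s u x y :
  eval_at (p ^+ 2 * q * r - s * q * u ^+ 2) x y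
  = eval_at p x y ^+ 2 * eval_at q x y * eval_at r x y
    - eval_at s x y * eval_at q x y * eval_at u x y ^+ 2.
Proof. by rewrite !eval_atE. Qed.

Lemma eval_at_phi_rec p q r x y :
  eval_at (varx * p ^+ 2 - q * r) x y
  = x * eval_at p x y ^+ 2 - eval_at q x y * eval_at r x y.
Proof. by rewrite !eval_atE. Qed.

Lemma eval_at_omega_rec p q r s u v f g a b x y :
  eval_at (p ^+ 2 * q - r * s ^+ 2 - u * v * (cst a * f + cst b * g ^+ 2)) x y
  = eval_at p x y ^+ 2 * eval_at q x y - eval_at r x y * eval_at s x y ^+ 2
    - eval_at u x y * eval_at v x y
      * (a * eval_at f x y + b * eval_at g x y ^+ 2).
Proof. by rewrite !eval_atE. Qed.

Definition psi2_P (al : int) : int := - (al ^+ 3 * (al - 1) * (2 * al - 1)).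

Definition psi3_P (al : int) : int :=
  - (al ^+ 8 * (al - 1) ^+ 3 * (2 * al - 1) ^+ 3).

Definition psi4_P (al : int) : int :=
  al ^+ 14 * (al - 1) ^+ 6 * (2 * al - 1) ^+ 6.

(** The factor [t] of the quasi-periodicity, a cube root of [psi_7(P)]. *)
Definition ratio_P (al : int) : int :=
  - (al ^+ 15 * (al - 1) ^+ 7 * (2 * al - 1) ^+ 6).

Definition psi_P (al : int) : nat -> int :=
  eds8 (psi2_P al) (psi3_P al) (psi4_P al) (ratio_P al).

Lemma psi_P_compatible (al : int) :
  eds8_compatible (psi2_P al) (psi3_P al) (psi4_P al) (ratio_P al).
Proof. by split; rewrite /psi2_P /psi3_P /psi4_P /ratio_P; ring. Qed.

Lemma psi2_P_neq0 (al : int) : al != 0 -> al != 1 -> psi2_P al != 0.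
Proof.
move=> al0 al1; rewrite /psi2_P oppr_eq0 !mulf_neq0 ?expf_neq0 //.
  by clear -al0 al1; lia.
by clear; lia.
Qed.

Lemma psi_P2 (al : int) : psi_P al 2 = psi2_P al.
Proof. by rewrite /psi_P /eds8; ring. Qed.

(** Both sequences have the same terms up to index 4 and satisfy the same
    recurrences.  For even [n] these determine only [psi_2 psi_n], but
    [psi_2(P)] is nonzero. *)
Lemma psi_at_P al n : al != 0 -> al != 1 ->
  eval_at (psi (E8 al) n) 0 0 = (psi_P al n)%:~R.
Proof.
move=> al0 al1; have [m] := ubnP n; elim: m n => // m IH n ltnm.
have [lt4n|] := ltnP 4 n; last first.
  rewrite /psi_P /eds8; case: n ltnm => [|[|[|[|[|]]]]] // _ _.
  - by rewrite psi0 (eval_at_nat 0).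
  - by rewrite psi1 (eval_at_nat 1).
  - by rewrite psi2E /psi2 !eval_atE /= /psi2_P /beta; ring.
  - by rewrite psi3E /psi3 !eval_atE /b2 /b4 /b6 /b8 /= /psi3_P /beta; ring.
  - rewrite psi4E /psi4 /psi2 !eval_atE /b2 /b4 /b6 /b8 /= /psi4_P /beta.
    by ring.
have compat := psi_P_compatible al.
have En := odd_double_half n; case: (odd n) En => /= En; rewrite -En.
  have le2 : (2 <= n./2)%N by lia.
  rewrite add1n psi_odd // /psi_P (eds8_odd compat le2) -/(psi_P al).
  by rewrite eval_at_odd_rec !IH; [ring | lia..].
have le3 : (3 <= n./2)%N by lia.
have nz2 : ((psi2_P al)%:~R : rat) != 0 by rewrite intr_eq0 psi2_P_neq0.
have E2 : eval_at (psi (E8 al) 2) 0 0 = (psi2_P al)%:~R.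
  by rewrite IH ?psi_P2 //; lia.
apply: (mulIf nz2); rewrite add0n -{1}E2 -eval_atM psi_even //.
rewrite -rmorphM -psi_P2 /psi_P (eds8_even compat le3) -/(psi_P al).
by rewrite eval_at_even_rec !IH; [ring | lia..].
Qed.

Lemma Gseq_val (al : int) k j : al != 0 -> al != 1 ->
  Gseq al (8 * k + (j + 2))
  = (ratio_P al ^+ (2 * (4 * k ^ 2 + (j + 2) * k))%N
     * - (psi_P al (j + 3)%N * psi_P al (j + 1)%N))%:~R.
Proof.
move=> al0 al1; have -> : (8 * k + (j + 2) = (8 * k + j).+2)%N by lia.
rewrite /Gseq /phi eval_at_phi_rec mul0r sub0r !psi_at_P //.
have -> : ((8 * k + j).+3 = 8 * k + (j + 3))%N by lia.
have -> : ((8 * k + j).+2.-1 = 8 * k + (j + 1))%N by rewrite /=; lia.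
by rewrite -rmorphM /psi_P eds8_phi -rmorphN mulrN.
Qed.

(** Dividing [omega_form] by [2 psi_2(P)] commutes with the quasi-periodicity,
    so it is enough to know the quotient [h] in the first window. *)
Lemma Hseq_val (al : int) k j h : al != 0 -> al != 1 ->
  omega_form (psi2_P al) (psi3_P al) (psi4_P al) (ratio_P al) (al - beta al) j
    = 2 * psi2_P al * h ->
  Hseq al (8 * k + (j + 2))
  = ((-1) ^+ k * ratio_P al ^+ (3 * (4 * k ^ 2 + (j + 2) * k)) * h)%:~R.
Proof.
move=> al0 al1 Eh.
have nz : ((2 * psi2_P al)%:~R : rat) != 0.
  by rewrite intr_eq0 mulf_neq0 ?psi2_P_neq0.
apply: (mulIf nz); rewrite -rmorphM mulrAC -mulrA -Eh -eds8_omega.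
have -> : Hseq al (8 * k + (j + 2)) * (2 * psi2_P al)%:~R
  = eval_at (omega_num (E8 al) (8 * k + (j + 2))) 0 0.
  rewrite -omegaE; last by lia.
  rewrite eval_atM [eval_at (2 * _) _ _]eval_atM (eval_at_nat 2).
  by rewrite psi_at_P // psi_P2 rmorphM.
have Gphi : eval_at (phi (E8 al) (8 * k + (j + 2))) 0 0
    = (- (psi_P al (8 * k + (j + 3))%N * psi_P al (8 * k + (j + 1))%N))%:~R.
  by rewrite -/(Gseq al _) Gseq_val // /psi_P eds8_phi mulrN.
rewrite /omega_num eval_at_omega_rec Gphi !psi_at_P //.
have -> : ((8 * k + (j + 2)).+2 = 8 * k + j + 4)%N by lia.
have -> : ((8 * k + (j + 2)).-2 = 8 * k + j + 0)%N by lia.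
have -> : ((8 * k + (j + 2)).-1 = 8 * k + j + 1)%N by lia.
have -> : ((8 * k + (j + 2)).+1 = 8 * k + j + 3)%N by lia.
rewrite !addnA /omega_form -/(psi_P al) psi_P2 /=.
have -> : (- (al ^+ 3 * beta al))%:~R = (psi2_P al)%:~R :> rat.
  by congr (_%:~R); rewrite /psi2_P /beta; ring.
move: (psi_P _ _) (psi_P _ _) (psi_P _ _) (psi_P _ _) (psi_P _ _) => *.
by ring.
Qed.

(** This is [psi_4 = psi_2 (b_4 b_8 - b_6^2)] at [(0, 0)], where [psi_2 = a_3],
    [psi_3 = b_8], [b_4 = a_1 a_3] and [b_6 = a_3^2]. *)
Lemma psi4_P_rec (al : int) :
  psi4_P al
  = (al - beta al) * psi2_P al ^+ 2 * psi3_P al - psi2_P al ^+ 5.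
Proof. by rewrite /psi2_P /psi3_P /psi4_P /beta; ring. Qed.

(** The second half of the window, where the symmetry of the sequence lets a
    power of [t] be factored out. *)
Lemma omega_form_late (R : comNzRingType) (c2 c3 c4 t a : R) :
  c4 = a * c2 ^+ 2 * c3 - c2 ^+ 5 ->
  let w := omega_form c2 c3 c4 t a in
  [/\ w 3 = t ^+ 3 * (c4 ^+ 2 - t * c2 ^+ 2 * c3 + a * c2 ^+ 2 * c3 * c4
                      - c2 ^+ 2 * c3 ^+ 3),
      w 4 = 0, w 5 = 2 * c2 * - (t ^+ 9 * c2), w 6 = 2 * c2 * - t ^+ 12
    & w 7 = 0].
Proof. by move=> ->; split; rewrite /omega_form /eds8 ![nth _ _ _]/=; ring. Qed.

(** The values of [omega_2(P)], ..., [omega_9(P)]. *)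
Definition omega_val (m : int) (j : nat) : int :=
  let x := m in let y := m - 1 in let z := 2 * m - 1 in
  nth 0 [:: - (x ^+ 11 * y ^+ 5 * z ^+ 5); - (x ^+ 26 * y ^+ 11 * z ^+ 10);
    x ^+ 46 * y ^+ 20 * z ^+ 18;
    - (ratio_P m ^+ 3 * (x ^+ 25 * y ^+ 11 * z ^+ 11)); 0;
    - (ratio_P m ^+ 9 * psi2_P m); - ratio_P m ^+ 12; 0] j.

Lemma omega_form_val (al : int) j : (j < 8)%N ->
  omega_form (psi2_P al) (psi3_P al) (psi4_P al) (ratio_P al) (al - beta al) j
  = 2 * psi2_P al * omega_val al j.
Proof.
have [E3 E4 E5 E6 E7] := omega_form_late (ratio_P al) (psi4_P_rec al).
case: j => [|[|[|[|[|[|[|[|//]]]]]]]] _; rewrite /omega_val [nth _ _ _]/=.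
1-3: rewrite /omega_form /eds8 ![nth _ _ _]/=.
1-3: by rewrite /psi2_P /psi3_P /psi4_P /ratio_P /beta; ring.
- rewrite E3 (_ : _ - _ = 2 * psi2_P al
      * - (al ^+ 25 * (al - 1) ^+ 11 * (2 * al - 1) ^+ 11)); first by ring.
  by rewrite /psi2_P /psi3_P /psi4_P /ratio_P /beta; ring.
- by rewrite E4 mulr0.
- by rewrite E5.
- by rewrite E6.
- by rewrite E7 mulr0.
Qed.

(** * The numerators as monomials *)

Definition scale_exponents (E : nat) (abc : nat * nat * nat) :=
  (15 * E + abc.1.1, 7 * E + abc.1.2, 6 * E + abc.2)%N.

Lemma absz_ratio_P (al v : int) (E : nat) abc :
  `|v|%N = monomial3 al abc ->
  `|(ratio_P al ^+ E * v)%R|%N = monomial3 al (scale_exponents E abc).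
Proof.
move=> Ev; rewrite abszM Ev abszX /ratio_P abszN !(abszX, abszM) /monomial3 /=.
by rewrite 2!expnMn -!expnM !expnD; ring.
Qed.

(** Exponents of [phi_2(P)], ..., [phi_9(P)]; the terms 7 and 9 vanish, and
    their entries are placeholders. *)
Definition G_exponents : seq (nat * nat * nat) :=
  [:: (8, 3, 3); (17, 7, 7); (31, 13, 12); (47, 21, 19); (68, 31, 27);
      (0, 0, 0); (120, 56, 48); (0, 0, 0)]%N.

(** Exponents of [omega_2(P)], ..., [omega_9(P)], with the same convention for
    the vanishing terms 6 and 9. *)
Definition H_exponents : seq (nat * nat * nat) :=
  [:: (11, 5, 5); (26, 11, 10); (46, 20, 18); (70, 32, 29); (0, 0, 0);
      (138, 64, 55); (180, 84, 72); (0, 0, 0)]%N.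

Lemma Gseq_monomial (al : int) k j : al != 0 -> al != 1 -> (j < 8)%N ->
  let E := (2 * (4 * k ^ 2 + (j + 2) * k))%N in
  Gseq al (8 * k + (j + 2)) != 0 ->
  (j \notin [:: 5; 7]%N) /\ exists m : int,
  [/\ Gseq al (8 * k + (j + 2)) = m%:~R, m != 0
    & `|m|%N = monomial3 al
        (scale_exponents E (nth (0, 0, 0) G_exponents j)%N)].
Proof.
move=> al0 al1 lt_j8 E; rewrite Gseq_val // -/E intr_eq0 => nz.
suff [jn Em] : (j \notin [:: 5; 7]%N) /\
    `|(- (psi_P al (j + 3)%N * psi_P al (j + 1)%N))%R|%N
    = monomial3 al (nth (0, 0, 0) G_exponents j)%N.
  split=> //; eexists; split; [reflexivity | by [] | exact: absz_ratio_P].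
move: nz; rewrite mulf_eq0 negb_or => /andP[_]; rewrite /psi_P /eds8.
case: j lt_j8 {E} => [|[|[|[|[|[|[|[|//]]]]]]]] _; rewrite ![nth _ _ _]/=.
all: rewrite ?(mulr0, mul0r) ?oppr0 ?eqxx //= => _; split=> //.
all: rewrite /psi2_P /psi3_P /psi4_P /ratio_P !(abszX, abszN, abszM).
all: by rewrite /monomial3 /=; ring.
Qed.

Lemma Hseq_monomial (al : int) k j : al != 0 -> al != 1 -> (j < 8)%N ->
  let E := (3 * (4 * k ^ 2 + (j + 2) * k))%N in
  Hseq al (8 * k + (j + 2)) != 0 ->
  (j \notin [:: 4; 7]%N) /\ exists m : int,
  [/\ Hseq al (8 * k + (j + 2)) = m%:~R, m != 0
    & `|m|%N = monomial3 al
        (scale_exponents E (nth (0, 0, 0) H_exponents j)%N)].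
Proof.
move=> al0 al1 lt_j8 E.
rewrite (Hseq_val k al0 al1 (omega_form_val al lt_j8)) -/E intr_eq0 => nz.
suff [jn Em] : (j \notin [:: 4; 7]%N) /\
    `|omega_val al j|%N = monomial3 al (nth (0, 0, 0) H_exponents j)%N.
  split=> //; eexists; split; [reflexivity | by [] |].
  by rewrite -mulrA abszM abszX abszN exp1n mul1n; apply: absz_ratio_P.
move: nz; rewrite mulf_eq0 negb_or => /andP[_]; rewrite /omega_val.
case: j lt_j8 {E} => [|[|[|[|[|[|[|[|//]]]]]]]] _; rewrite ![nth _ _ _]/=.
all: rewrite ?eqxx //= => _; split=> //.
all: rewrite /psi2_P /ratio_P !(abszX, abszN, abszM).
all: by rewrite /monomial3 /=; ring.
Qed.

Lemma first_multiples (al : int) :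
  [/\ Gseq al 0 = 1, Gseq al 1 = 0, Hseq al 0 = 1 & Hseq al 1 = 0].
Proof.
by split; [exact: (eval_at_nat 1) | exact: eval_at_varx
         | exact: (eval_at_nat 1) | exact: eval_at_vary].
Qed.

(** * Squares and cubes among the numerators *)

Ltac decide_dvd :=
  repeat match goal with |- context [(?p %| ?e)%N] =>
    first [ have -> : (p %| e)%N = true by clear; lia
          | have -> : (p %| e)%N = false by clear; lia ]
  end.

(** Once the divisibility tests on the exponents are decided, each clause is a
    propositional consequence of the exclusions between [alpha], [alpha - 1]
    and [2 alpha - 1]; [isT] is put in the context for the tests that
    succeed. *)
Ltac decide_by_exponents :=
  rewrite /scale_exponents /=; decide_dvd; have := isT; move=> ? ?;
  repeat split=> //; intuition by [].

Lemma Gseq_squares (al : int) n : al != 0 -> al != 1 -> Gseq al n != 0 ->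
  [/\ (n %% 8 = 0)%N -> is_pm_square (Gseq al n),
      (n %% 8)%N \in [:: 2; 6]%N ->
        (is_pm_square (Gseq al n) <-> is_pm_square ((al - 1) * (2 * al - 1)))
    & (n %% 8)%N \notin [:: 0; 2; 6]%N -> ~ is_pm_square (Gseq al n)].
Proof.
move=> al0 al1; have [G0 G1 _ _] := first_multiples al.
elim/window8_ind: n => [||k j lt_j8].
- by rewrite G0; split=> // _; exists 1; [|left].
- by rewrite G1 eqxx.
case/(Gseq_monomial al0 al1 lt_j8)=> jn [m [-> m0 Em]].
have nxy := squares_m_pred al0 al1.
have yz : is_pm_square ((al - 1) * (2 * al - 1)) <->
    perfect_power 2 `|(al - 1)%R| /\ perfect_power 2 `|(2 * al - 1)%R|.
  have Eyz : `|((al - 1) * (2 * al - 1))%R|%N = monomial3 al (0, 1, 1)%N.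
    by rewrite /monomial3 /= abszM expn0 mul1n !expn1.
  have nz : (al - 1) * (2 * al - 1) != 0.
    by rewrite mulf_neq0 ?subr_eq0 //; clear; lia.
  have := is_pm_squareP int nz; rewrite intz Eyz => yz; apply: iff_trans yz _.
  apply: iff_trans (@perfect_power_monomial 2 _ _ isT al0 al1) _.
  by split=> [[? [[//|?] [//|?]]]|[? ?]]; repeat split; auto.
have := monomial_is_pm_square al0 al1 m0 Em.
move: (is_pm_square m%:~R) (is_pm_square (_ * _)) (perfect_power 2 `|al|%N)
  (perfect_power 2 `|(al - 1)%R|) (perfect_power 2 `|(2 * al - 1)%R|) nxy yz
  => G YZ X Y Z nxy yz.
move: (4 * k ^ 2 + (j + 2) * k)%N => M.
have -> : ((8 * k + (j + 2)) %% 8 = (j + 2) %% 8)%N by rewrite mulnC modnMDl.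
case: j lt_j8 jn {Em} => [|[|[|[|[|[|[|[|//]]]]]]]] _ // _;
  rewrite ![nth _ _ _]/= ![((_ + 2) %% 8)%N]/= !inE /=; decide_by_exponents.
Qed.

(** Only the exponent [7 E + b] of [alpha - 1] can change modulo 3 with the
    block [k]: hence the split of [k] modulo 3. *)
Lemma Gseq_cubes (al : int) n : al != 0 -> al != 1 -> Gseq al n != 0 ->
  [/\ (n %% 24 = 0)%N -> is_cube (Gseq al n),
      (n %% 24)%N \in [:: 2; 10; 14; 22]%N ->
        (is_cube (Gseq al n) <-> is_cube al),
      (n %% 24)%N \in [:: 8; 16]%N ->
        (is_cube (Gseq al n) <-> is_cube (al - 1))
    & (n %% 24)%N \notin [:: 0; 2; 8; 10; 14; 16; 22]%N ->
        ~ is_cube (Gseq al n)].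
Proof.
move=> al0 al1; have [G0 G1 _ _] := first_multiples al.
elim/window8_ind: n => [||k j lt_j8].
- by rewrite G0; split=> // _; exists 1.
- by rewrite G1 eqxx.
case/(Gseq_monomial al0 al1 lt_j8)=> jn [m [-> m0 Em]].
have nxy := cubes_m_pred al0 al1.
have nxz := cubes_m_double_pred al0 al1.
have nyz := cubes_pred_double_pred al0 al1.
have xE : is_cube al <-> perfect_power 3 `|al|.
  by rewrite -[X in is_cube X]intz; apply: is_cubeP.
have yE : is_cube (al - 1) <-> perfect_power 3 `|(al - 1)%R|.
  by rewrite -[X in is_cube X]intz; apply: is_cubeP; rewrite subr_eq0.
have := monomial_is_cube al0 al1 m0 Em.
move: (is_cube m%:~R) (is_cube al) (is_cube (al - 1)) (perfect_power 3 `|al|%N)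
  (perfect_power 3 `|(al - 1)%R|) (perfect_power 3 `|(2 * al - 1)%R|)
  nxy nxz nyz xE yE => G CX CY X Y Z nxy nxz nyz xE yE.
have [q [s [-> lt_s3]]] : exists q s, k = (3 * q + s)%N /\ (s < 3)%N.
  by exists (k %/ 3)%N, (k %% 3)%N; lia.
have [M ->] : exists M, (4 * (3 * q + s) ^ 2 + (j + 2) * (3 * q + s)
    = 3 * M + (4 * s ^ 2 + (j + 2) * s))%N.
  by exists (12 * q ^ 2 + 8 * q * s + (j + 2) * q)%N; ring.
have -> : ((8 * (3 * q + s) + (j + 2)) %% 24 = (8 * s + (j + 2)) %% 24)%N.
  by rewrite (_ : 8 * (3 * q + s) + (j + 2) = q * 24 + (8 * s + (j + 2)))%N;
    [rewrite modnMDl | ring].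
case: j lt_j8 jn {Em} => [|[|[|[|[|[|[|[|//]]]]]]]] _ // _;
  rewrite ![nth _ _ _]/=.
all: case: s lt_s3 => [|[|[|//]]] _; rewrite ![(_ %% 24)%N]/= !inE /=.
all: decide_by_exponents.
Qed.

(** Here [E] is odd for [k] and [n] odd, which changes the parities of the
    exponents of [alpha] and [alpha - 1]: hence the split of [k] modulo 2. *)
Lemma Hseq_squares (al : int) n : al != 0 -> al != 1 -> Hseq al n != 0 ->
  [/\ (n %% 16)%N \in [:: 0; 4; 8; 12]%N -> is_pm_square (Hseq al n),
      (n %% 16 = 3)%N ->
        (is_pm_square (Hseq al n) <-> is_pm_square (al - 1)),
      (n %% 16)%N \in [:: 5; 7]%N ->
        (is_pm_square (Hseq al n) <-> is_pm_square (2 * al - 1)),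
      (n %% 16 = 11)%N ->
        (is_pm_square (Hseq al n) <-> is_pm_square al)
    & (n %% 16)%N \notin [:: 0; 3; 4; 5; 7; 8; 11; 12]%N ->
        ~ is_pm_square (Hseq al n)].
Proof.
move=> al0 al1; have [_ _ H0 H1] := first_multiples al.
elim/window8_ind: n => [||k j lt_j8].
- by rewrite H0; split=> // _; exists 1; [|left].
- by rewrite H1 eqxx.
case/(Hseq_monomial al0 al1 lt_j8)=> jn [m [-> m0 Em]].
have nxy := squares_m_pred al0 al1.
have xE : is_pm_square al <-> perfect_power 2 `|al|.
  by rewrite -[X in is_pm_square X]intz; apply: is_pm_squareP.
have yE : is_pm_square (al - 1) <-> perfect_power 2 `|(al - 1)%R|.
  by rewrite -[X in is_pm_square X]intz; apply: is_pm_squareP; rewrite subr_eq0.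
have zE : is_pm_square (2 * al - 1) <-> perfect_power 2 `|(2 * al - 1)%R|.
  by rewrite -[X in is_pm_square X]intz; apply: is_pm_squareP; clear; lia.
have := monomial_is_pm_square al0 al1 m0 Em.
move: (is_pm_square m%:~R) (is_pm_square al) (is_pm_square (al - 1))
  (is_pm_square (2 * al - 1)) (perfect_power 2 `|al|%N)
  (perfect_power 2 `|(al - 1)%R|) (perfect_power 2 `|(2 * al - 1)%R|)
  nxy xE yE zE => H SX SY SZ X Y Z nxy xE yE zE.
have [q [s [-> lt_s2]]] : exists q s, k = (2 * q + s)%N /\ (s < 2)%N.
  by exists (k %/ 2)%N, (k %% 2)%N; lia.
have [M ->] : exists M, (4 * (2 * q + s) ^ 2 + (j + 2) * (2 * q + s)
    = 2 * M + (4 * s ^ 2 + (j + 2) * s))%N.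
  by exists (8 * q ^ 2 + 8 * q * s + (j + 2) * q)%N; ring.
have -> : ((8 * (2 * q + s) + (j + 2)) %% 16 = (8 * s + (j + 2)) %% 16)%N.
  by rewrite (_ : 8 * (2 * q + s) + (j + 2) = q * 16 + (8 * s + (j + 2)))%N;
    [rewrite modnMDl | ring].
case: j lt_j8 jn {Em} => [|[|[|[|[|[|[|[|//]]]]]]]] _ // _;
  rewrite ![nth _ _ _]/=.
all: case: s lt_s2 => [|[|//]] _; rewrite ![(_ %% 16)%N]/= !inE /=.
all: decide_by_exponents.
Qed.

Lemma Hseq_cubes (al : int) n : al != 0 -> al != 1 -> Hseq al n != 0 ->
  ((n %% 8 = 0)%N -> is_cube (Hseq al n)) /\
  ((n %% 8 <> 0)%N -> ~ is_cube (Hseq al n)).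
Proof.
move=> al0 al1; have [_ _ H0 H1] := first_multiples al.
elim/window8_ind: n => [||k j lt_j8].
- by rewrite H0; split=> // _; exists 1.
- by rewrite H1 eqxx.
case/(Hseq_monomial al0 al1 lt_j8)=> jn [m [-> m0 Em]].
have nxy := cubes_m_pred al0 al1.
have nxz := cubes_m_double_pred al0 al1.
have nyz := cubes_pred_double_pred al0 al1.
have := monomial_is_cube al0 al1 m0 Em.
move: (is_cube m%:~R) (perfect_power 3 `|al|%N) (perfect_power 3 `|(al - 1)%R|)
  (perfect_power 3 `|(2 * al - 1)%R|) nxy nxz nyz => H X Y Z nxy nxz nyz.
move: (4 * k ^ 2 + (j + 2) * k)%N => M.
have -> : ((8 * k + (j + 2)) %% 8 = (j + 2) %% 8)%N by rewrite mulnC modnMDl.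
case: j lt_j8 jn {Em} => [|[|[|[|[|[|[|[|//]]]]]]]] _ // _;
  rewrite ![nth _ _ _]/=; decide_by_exponents.
Qed.

Theorem theorem5p1 (alpha : int) (n : nat) :
  alpha != 0 -> alpha != 1 ->
  (Gseq alpha n != 0 ->
     [/\ (n %% 8 = 0)%N -> is_pm_square (Gseq alpha n),
         (n %% 8)%N \in [:: 2; 6]%N ->
           (is_pm_square (Gseq alpha n) <->
            is_pm_square ((alpha - 1) * (2 * alpha - 1)))
       & (n %% 8)%N \notin [:: 0; 2; 6]%N -> ~ is_pm_square (Gseq alpha n)]
     /\
     [/\ (n %% 24 = 0)%N -> is_cube (Gseq alpha n),
         (n %% 24)%N \in [:: 2; 10; 14; 22]%N ->
           (is_cube (Gseq alpha n) <-> is_cube alpha),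
         (n %% 24)%N \in [:: 8; 16]%N ->
           (is_cube (Gseq alpha n) <-> is_cube (alpha - 1))
       & (n %% 24)%N \notin [:: 0; 2; 8; 10; 14; 16; 22]%N ->
           ~ is_cube (Gseq alpha n)])
  /\
  (Hseq alpha n != 0 ->
     [/\ (n %% 16)%N \in [:: 0; 4; 8; 12]%N -> is_pm_square (Hseq alpha n),
         (n %% 16 = 3)%N ->
           (is_pm_square (Hseq alpha n) <-> is_pm_square (alpha - 1)),
         (n %% 16)%N \in [:: 5; 7]%N ->
           (is_pm_square (Hseq alpha n) <-> is_pm_square (2 * alpha - 1)),
         (n %% 16 = 11)%N ->
           (is_pm_square (Hseq alpha n) <-> is_pm_square alpha)
       & (n %% 16)%N \notin [:: 0; 3; 4; 5; 7; 8; 11; 12]%N ->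
           ~ is_pm_square (Hseq alpha n)]
     /\
     ((n %% 8 = 0)%N -> is_cube (Hseq alpha n)) /\
     ((n %% 8 <> 0)%N -> ~ is_cube (Hseq alpha n))).
Proof.
move=> al0 al1; split=> [nzG | nzH].
  by split; [exact: Gseq_squares | exact: Gseq_cubes].
by split; [exact: Hseq_squares | exact: Hseq_cubes].
Qed.
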